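(* Let $(a_k)_{k=0}^\infty$ be a $\mathrm{TP}_\infty$-preserver. Then for every $l\in\mathbb{N}\cup\{0\}$ the remainder $R_l[A](z)=\sum_{k=l}^\infty a_k z^k$ of the generating function $A(z)=\sum_{k=0}^\infty a_k z^k$ is the generating function of a totally positive sequence; that is, the sequence whose $k$-th term is $0$ for $0\le k<l$ and $a_k$ for $k\ge l$ is totally positive.
   Context: A real sequence $(a_k)_{k=0}^\infty$ is called totally positive (belongs to $\mathrm{TP}_\infty$) if all minors of the infinite upper triangular Toeplitz matrix $\|a_{j-i}\|_{i,j=0}^\infty$ are nonnegative, where $a_k=0$ for $k<0$. A sequence $(a_k)_{k=0}^\infty$ of nonnegative real numbers is called a $\mathrm{TP}_\infty$-preserver if for every totally positive sequence $(b_k)_{k=0}^\infty$ the termwise product $(a_k b_k)_{k=0}^\infty$ is totally positive. *)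

(* Defs.v *)
From HB Require Import structures.
From mathcomp Require Import all_boot all_order all_algebra.
From mathcomp Require Import reals.

Set Implicit Arguments.
Unset Strict Implicit.
Unset Printing Implicit Defensive.

Import Order.TTheory GRing.Theory Num.Theory.

Local Open Scope ring_scope.

Definition toeplitz (R : realType) (a : nat -> R) (i j : nat) : R :=
  if (i <= j)%N then a (j - i)%N else 0.

Definition minor (R : realType) (M : nat -> nat -> R) (n : nat)
    (r c : 'I_n -> nat) : R :=
  \det (\matrix_(p < n, q < n) M (r p) (c q)).

Definition totally_positive (R : realType) (a : nat -> R) : Prop :=
  forall (n : nat) (r c : 'I_n -> nat),
    {homo r : p q / (p < q)%N} -> {homo c : p q / (p < q)%N} ->
    0 <= minor (toeplitz a) r c.

Definition TP_preserver (R : realType) (a : nat -> R) : Prop :=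
  (forall k : nat, 0 <= a k) /\
  forall b : nat -> R,
    totally_positive b -> totally_positive (fun k => a k * b k).

(* A power series is represented by its sequence of coefficients, so this is
   the series \sum_(k >= l) a_k z^k. *)
Definition remainder (R : realType) (l : nat) (a : nat -> R) : nat -> R :=
  fun k => if (k < l)%N then 0 else a k.

(* Main.v *)
Require Import Defs.
From mathcomp Require Import all_boot all_order all_algebra.
From mathcomp Require Import reals.

(** The remainder of order [l] is the termwise product of [a] with the sequence
    [0, ..., 0, 1, 1, 1, ...] starting with [l] zeros, whose generating function
    is [z^l / (1 - z)].  As [a] is a preserver, it is enough that this step
    sequence be totally positive.  Its Toeplitz minors are determinants of 0-1
    matrices of the form [f p <= g q] with [f] and [g] monotone: the ones fill a
    staircase.  Such a determinant is 0 or 1, because either two rows coincide,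
    or the first column vanishes, or the first column is the first basis vector
    and the matrix left after deleting the first row and column is again a
    staircase ([det_staircase_ge0]). *)

Import Order.TTheory GRing.Theory Num.Theory.
Local Open Scope ring_scope.

(** The induction removes the first row and the first column.  If the first
    column has a nonzero entry in some row [i] other than the first, then by
    monotonicity both row [i] and the first row consist of ones only, so the
    determinant vanishes; otherwise only the corner entry contributes to the
    expansion along the first column. *)
Lemma det_staircase_ge0 (R : numDomainType) (n : nat) (f g : 'I_n -> nat) :
    {homo f : p q / (p <= q)%N} -> {homo g : p q / (p <= q)%N} ->
  0 <= \det (\matrix_(p < n, q < n) (f p <= g q)%N%:R : 'M[R]_n).
Proof.
elim: n f g => [|n IHn] f g fmono gmono; first by rewrite det_mx00.
case: (pickP [pred i : 'I_n | (f (lift ord0 i) <= g ord0)%N]) => [i /= fi|no_i].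
  rewrite (determinant_alternate (neq_lift ord0 i)) // => q; rewrite !mxE.
  have fiq : (f (lift ord0 i) <= g q)%N by apply: leq_trans fi (gmono _ _ _).
  by rewrite fiq (leq_trans (fmono ord0 (lift ord0 i) _) fiq).
rewrite (expand_det_col _ ord0) big_ord_recl big1 => [|i _]; last first.
  by have /= gt_fg := no_i i; rewrite mxE gt_fg mul0r.
rewrite addr0 mxE mulr_ge0 ?ler0n // /cofactor expr0 mul1r.
have -> : row' ord0 (col' ord0 (\matrix_(p, q) (f p <= g q)%N%:R)) =
    \matrix_(p, q) (f (lift ord0 p) <= g (lift ord0 q))%N%:R :> 'M[R]_n.
  by apply/matrixP=> p q; rewrite !mxE.
by apply: IHn => p q pq; [apply: fmono|apply: gmono]; rewrite /= leq_bump2.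
Qed.

Lemma step_totally_positive (R : realType) (l : nat) :
  totally_positive (fun k => (l <= k)%N%:R : R).
Proof.
move=> n r c rmono cmono.
rewrite /minor (_ : \matrix_(_, _) _ = \matrix_(p, q) (r p + l <= c q)%N%:R).
  apply: det_staircase_ge0 => p q; rewrite leq_eqVlt => /predU1P[/val_inj-> //|].
    by move=> /rmono/ltnW; rewrite leq_add2r.
  by move=> /cmono/ltnW.
apply/matrixP => p q; rewrite !mxE /toeplitz.
case: leqP => [le_rc|lt_cr]; first by rewrite leq_subRL.
by rewrite leqNgt ltn_addr.
Qed.

Theorem theorem1p11 (R : realType) (a : nat -> R) (ha : TP_preserver a)
  (l : nat) : totally_positive (remainder l a).
Proof.
have [_ /(_ _ (step_totally_positive R l)) tp] := ha.
move=> n r c rmono cmono; have := tp n r c rmono cmono.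
congr (0 <= \det _); apply/matrixP => p q; rewrite !mxE /toeplitz /remainder.
by case: ifP => // _; case: ltnP => _; rewrite ?mulr0 ?mulr1.
Qed.
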